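(* For every unit vector $|\psi\rangle\in\mathrm{span}(\mathcal{V})$, $$\Gamma^\cup_{\mathcal{S}_+}(|\psi\rangle\langle\psi|)=\Gamma_{\mathcal{V}}(|\psi\rangle)^2,\qquad \Gamma_{\mathcal{S}}(|\psi\rangle\langle\psi|)=\Gamma_{\mathcal{V}}(|\psi\rangle)^2 .$$ For every unit vector $|\psi\rangle\in\mathbb{C}^d$, $$\Gamma^\circ_{\mathcal{S}_+}(|\psi\rangle\langle\psi|)=\Gamma^\circ_{\mathcal{V}}(|\psi\rangle)^2,\qquad \Gamma^\circ_{\mathcal{S}}(|\psi\rangle\langle\psi|)=\Gamma^\circ_{\mathcal{V}}(|\psi\rangle)^2 .$$
   Context: Fix $d\ge 1$. $\mathcal{V}\subseteq\mathbb{C}^d$ is a nonempty compact set of unit vectors such that $|\psi\rangle\in\mathcal{V}$ implies $e^{i\theta}|\psi\rangle\in\mathcal{V}$ for all real $\theta$. Put $\mathcal{S}_+=\{|v\rangle\langle v| : |v\rangle\in\mathcal{V}\}$ (in the real space of Hermitian matrices with inner product $\langle A,B\rangle=\mathrm{Tr}(AB)$) and $\mathcal{S}=\{|v\rangle\langle w| : |v\rangle,|w\rangle\in\mathcal{V}\}\subseteq\mathbb{C}^{d\times d}$. For a compact set $\mathcal{A}$ in a finite-dimensional vector space, the atomic gauge is $\Gamma_{\mathcal{A}}(x)=\inf\{\lambda\in\mathbb{R}_+ : x\in\lambda\,\mathrm{conv}(\mathcal{A})\}=\inf\{\sum_i c_i : x=\sum_i c_i a_i \text{ (finite sum)},\ a_i\in\mathcal{A},\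 c_i\in\mathbb{R}_+\}$, with $\inf\emptyset=\infty$. The polar gauges are $\Gamma^\circ_{\mathcal{V}}(|\psi\rangle)=\sup_{|v\rangle\in\mathcal{V}}|\langle\psi|v\rangle|$, $\Gamma^\circ_{\mathcal{S}_+}(X)=\max\{0,\sup_{|v\rangle\in\mathcal{V}}\langle v|X|v\rangle\}$ for Hermitian $X$, and $\Gamma^\circ_{\mathcal{S}}(X)=\sup_{|v\rangle,|w\rangle\in\mathcal{V}}|\langle v|X|w\rangle|$. The convex roof extension is, for a density matrix $\rho$, $$\Gamma^\cup_{\mathcal{S}_+}(\rho)=\inf\Big\{\sum_i p_i\,\Gamma_{\mathcal{V}}(|\psi_i\rangle)^2 : \rho=\sum_i p_i|\psi_i\rangle\langle\psi_i|,\ \sum_i p_i=1,\ p_i\in\mathbb{R}_+\Big\},$$ where the infimum is over finite decompositions with $|\psi_i\rangle$ unit vectors. *)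

(* Defs.v *)
From HB Require Import structures.
From mathcomp Require Import all_boot all_order all_algebra.
From mathcomp Require Import complex.
From mathcomp Require Import all_classical all_reals all_analysis.

Set Implicit Arguments.
Unset Strict Implicit.
Unset Printing Implicit Defensive.

Import Order.TTheory GRing.Theory Num.Theory.
Import numFieldNormedType.Exports.

Local Open Scope ring_scope.
Local Open Scope classical_set_scope.
Local Open Scope complex_scope.
Local Open Scope sesquilinear_scope.

(** <v|w>, conjugate-linear in v; kets are column vectors. *)
Definition braket (R : realType) (d : nat) (v w : 'cV[R[i]]_d) : R[i] :=
  (v ^t* *m w) 0 0.

(** |v><w| *)
Definition ketbra (R : realType) (d : nat) (v w : 'cV[R[i]]_d) : 'M[R[i]]_d :=
  v *m w ^t*.

(** <v|X|w> *)
Definition sandwich (R : realType) (d : nat) (v : 'cV[R[i]]_d)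
    (X : 'M[R[i]]_d) (w : 'cV[R[i]]_d) : R[i] :=
  braket v (X *m w).

Definition unit_vector (R : realType) (d : nat) (v : 'cV[R[i]]_d) : Prop :=
  braket v v = 1.

Definition expi (R : realType) (t : R) : R[i] := cos t +i* sin t.

(** [R[i]] has no topology of its own in the library; its norm topology is
    carried by the regular-algebra alias [R[i]^o]. *)
Definition compact_vectors (R : realType) (d : nat) (V : set 'cV[R[i]]_d) :
    Prop :=
  compact (V : set 'cV[R[i]^o]_d).

Definition in_span (R : realType) (d : nat) (V : set 'cV[R[i]]_d)
    (x : 'cV[R[i]]_d) : Prop :=
  exists2 s : seq 'cV[R[i]]_d, (forall v, v \in s -> V v) & x \in span s.

(** The coefficients are real; they act on the complex space [W] through the
    embedding of [R] into [R[i]].  The value is [+oo] when [x] has no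
    decomposition ([ereal_inf set0 = +oo]). *)
Definition gauge (R : realType) (W : lmodType R[i]) (A : set W) (x : W) :
    \bar R :=
  ereal_inf [set l : \bar R |
    exists (n : nat) (c : 'I_n -> R) (a : 'I_n -> W),
      [/\ forall k, 0 <= c k,
          forall k, A (a k),
          x = \sum_(k < n) (c k)%:C *: a k
        & l = (\sum_(k < n) c k)%:E]].

Definition atoms_S (R : realType) (d : nat) (V : set 'cV[R[i]]_d) :
    set 'M[R[i]]_d :=
  [set X | exists v w, [/\ V v, V w & X = ketbra v w]].

(** Infimum over finite decompositions of [rho] (meant to be a density matrix)
    as a convex combination of pure states.  In [\bar R], [0 * +oo = 0], so a
    zero-weight term contributes nothing even if its gauge is infinite. *)
Definition convex_roof (R : realType) (d : nat) (V : set 'cV[R[i]]_d)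
    (rho : 'M[R[i]]_d) : \bar R :=
  ereal_inf [set l : \bar R |
    exists (n : nat) (p : 'I_n -> R) (psi : 'I_n -> 'cV[R[i]]_d),
      [/\ forall k, 0 <= p k,
          \sum_(k < n) p k = 1,
          forall k, unit_vector (psi k),
          rho = \sum_(k < n) (p k)%:C *: ketbra (psi k) (psi k)
        & l = (\sum_(k < n) (p k)%:E * gauge V (psi k) ^+ 2)%E]].

Definition polar_V (R : realType) (d : nat) (V : set 'cV[R[i]]_d)
    (psi : 'cV[R[i]]_d) : \bar R :=
  ereal_sup [set (Normc.normc (braket psi v))%:E | v in V].

(** For Hermitian [X], <v|X|v> is real, so taking [Re] is only a coercion. *)
Definition polar_Splus (R : realType) (d : nat) (V : set 'cV[R[i]]_d)
    (X : 'M[R[i]]_d) : \bar R :=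
  maxe 0%E (ereal_sup [set (complex.Re (sandwich v X v))%:E | v in V]).

Definition polar_S (R : realType) (d : nat) (V : set 'cV[R[i]]_d)
    (X : 'M[R[i]]_d) : \bar R :=
  ereal_sup [set l : \bar R |
    exists v w, [/\ V v, V w & l = (Normc.normc (sandwich v X w))%:E]].

(* Main.v *)
(** Only the lower bound on the gauge of [|psi><psi|] over [S] needs convex
    duality.  Given a decomposition of [|psi><psi|] as a sum of
    [c_k |v_k><w_k|], we need a vector [u] with [|<u|v>| <= 1] on the finitely
    many atoms involved and [Re <u|psi>] equal to the gauge of [psi]:
    sandwiching the decomposition between [u] and itself bounds the squared
    gauge by the sum of the [c_k].  Such a [u] comes from a finite-dimensional
    Hahn-Banach argument: a sublinear [p] can be made linear along a vector [e]
    by passing to the smaller sublinear function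
    [x |-> inf_(t >= 0) p (x + t e) - t p e], and doing this along a real basis,
    starting with [psi], yields a linear functional below [p] that agrees with
    [p] at [psi].  The convex roof is trivial because a pure state only has
    decompositions into phase multiples of itself, and the polar gauges reduce
    to [<v|psi><psi|w>]. *)

Require Import Defs.
From HB Require Import structures.
From mathcomp Require Import all_boot all_order all_algebra.
From mathcomp Require Import complex.
From mathcomp Require Import all_classical all_reals all_analysis.
From mathcomp Require Import ring lra.

Set Implicit Arguments.
Unset Strict Implicit.
Unset Printing Implicit Defensive.

Import Order.TTheory GRing.Theory Num.Theory.
Import numFieldNormedType.Exports.

Local Open Scope ring_scope.
Local Open Scope classical_set_scope.

(** * Sublinear functions and their linearization along vectors *)

Section Sublinear.
Local Open Scope complex_scope.
Variables (R : realType) (E : lmodType R[i]).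
Implicit Types (p q : E -> R) (x y e : E) (t : R).

Definition sublinear p :=
  (forall x y, p (x + y) <= p x + p y) /\
  (forall t x, 0 <= t -> p (t%:C *: x) <= t * p x).

Lemma sublinear0 p : sublinear p -> p 0 = 0.
Proof.
move=> [pD pZ]; apply/eqP; rewrite eq_le; apply/andP; split.
  by have := pZ 0 0 (lexx _); rewrite scaler0 mul0r.
by have := pD 0 0; rewrite addr0; lra.
Qed.

Lemma sublinear_oppr_ge p x : sublinear p -> - p x <= p (- x).
Proof.
move=> sp; have := sp.1 x (- x); rewrite subrr sublinear0 //; lra.
Qed.

Lemma sublinearZ p t x : sublinear p -> 0 <= t -> p (t%:C *: x) = t * p x.
Proof.
move=> sp; rewrite le_eqVlt => /predU1P[<-|t0].
  by rewrite scale0r mul0r sublinear0.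
apply/eqP; rewrite eq_le sp.2 ?(ltW t0) //=.
have := sp.2 t^-1 (t%:C *: x); rewrite invr_ge0 (ltW t0) => /(_ isT).
rewrite scalerA -rmorphM mulVf ?gt_eqF // scale1r => h.
by rewrite -ler_pdivlMl.
Qed.

Definition directional p e x : R :=
  inf [set r | exists2 t, 0 <= t & r = p (x + t%:C *: e) - t * p e].

Section Directional.
Variables (p : E -> R) (e : E).
Hypothesis sp : sublinear p.

(** The real [inf] is a true infimum only for nonempty sets bounded below; this bound, from
    subadditivity, ensures it for [directional]. *)
Lemma directional_lbound x :
  lbound [set r | exists2 t, 0 <= t & r = p (x + t%:C *: e) - t * p e]
    (- p (- x)).
Proof.
move=> _ [t t0 ->]; rewrite -(sublinearZ e sp t0).
by have := sp.1 (x + t%:C *: e) (- x); rewrite addrAC subrr add0r; lra.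
Qed.

Lemma directional_le_shift x t :
  0 <= t -> directional p e x <= p (x + t%:C *: e) - t * p e.
Proof.
move=> t0; apply: ge_inf; last by exists t.
by exists (- p (- x)); exact: directional_lbound.
Qed.

Lemma directional_ge x r :
  (forall t, 0 <= t -> r <= p (x + t%:C *: e) - t * p e) ->
  r <= directional p e x.
Proof.
move=> rP; apply: lb_le_inf => [|_ [t t0 ->]]; last exact: rP.
by exists (p (x + 0%:C *: e) - 0 * p e), 0.
Qed.

Lemma directional_le x : directional p e x <= p x.
Proof.
have := directional_le_shift x (lexx 0).
by rewrite mul0r subr0 scale0r addr0.
Qed.

(** The shift [t = 1] cancels [- e]. Since [directional p e e <= p e], this yields oddness at
    [e]. *)
Lemma directional_opp : directional p e (- e) <= - p e.
Proof.
have := directional_le_shift (- e) (@ler01 R).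
by rewrite mul1r scale1r addNr (sublinear0 sp) sub0r.
Qed.

Lemma sublinear_directional : sublinear (directional p e).
Proof.
split=> [x y|t x].
- rewrite -lerBlDl; apply: directional_ge => s s0.
  rewrite lerBlDl -lerBlDr; apply: directional_ge => t t0.
  (* The shifts [t] of [x] and [s] of [y] combine into the shift [t + s] of [x + y], so the
     subtracted multiples of [p e] match. *)
  have := directional_le_shift (x + y) (addr_ge0 t0 s0).
  rewrite rmorphD scalerDl addrACA => h.
  have := sp.1 (x + t%:C *: e) (y + s%:C *: e); lra.
- rewrite le_eqVlt => /predU1P[<-|t0].
    by rewrite mul0r scale0r -(sublinear0 sp) directional_le.
  (* The shift [s] of [x] becomes, after scaling by [t], the shift [t * s] of the scaled vector. *)
  rewrite -ler_pdivrMl //; apply: directional_ge => s s0.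
  rewrite ler_pdivrMl // mulrBr -(sublinearZ _ sp (ltW t0)) scalerDr scalerA.
  by rewrite -rmorphM mulrA directional_le_shift // mulr_ge0 // ltW.
Qed.

End Directional.

(* Replacing [p] by [directional p e] only decreases it and makes it linear
   along [e]; directions treated earlier stay linear. *)
Lemma sublinear_linearize p (s : seq E) : sublinear p ->
  exists q, [/\ sublinear q, forall x, q x <= p x &
    {in s, forall x, q (- x) <= - q x}].
Proof.
elim: s p => [|e s IHs] p sp; first by exists p; split.
have [q [sq qp qs]] := IHs _ (sublinear_directional e sp).
exists q; split=> // [x|x].
  by apply: le_trans (qp _) _; exact: directional_le.
rewrite inE => /predU1P[->|/qs //].
apply: le_trans (qp _) _; apply: le_trans (directional_opp _ sp) _.
by rewrite lerN2; apply: le_trans (qp _) _; exact: directional_le.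
Qed.

(** Treating [e] first pins the value there: [- q e <= q (- e) <= - p e], and [q e <= p e]. *)
Lemma sublinear_linearize_at p e (s : seq E) : sublinear p ->
  exists q, [/\ sublinear q, forall x, q x <= p x, q e = p e &
    {in s, forall x, q (- x) <= - q x}].
Proof.
move=> sp.
have [q [sq qp qs]] := sublinear_linearize s (sublinear_directional e sp).
have qlep x : q x <= p x.
  by apply: le_trans (qp _) _; exact: directional_le.
exists q; split=> //; apply/eqP; rewrite eq_le qlep /= -lerN2.
apply: le_trans (sublinear_oppr_ge _ sq) _.
by apply: le_trans (qp _) _; exact: directional_opp.
Qed.

Section Odd.
Variable q : E -> R.
Hypothesis sq : sublinear q.

(** The inequality [q (- x) <= - q x] amounts to oddness at [x], its converse being automatic.
    Stability under sums and real multiples spreads it from a real basis to the whole space. *)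
Lemma sublinear_oddD x y :
  q (- x) <= - q x -> q (- y) <= - q y -> q (- (x + y)) <= - q (x + y).
Proof.
move=> hx hy; rewrite opprD.
by have := sq.1 (- x) (- y); have := sq.1 x y; lra.
Qed.

Lemma sublinear_oddZ t x :
  q (- x) <= - q x -> q (- (t%:C *: x)) <= - q (t%:C *: x).
Proof.
move=> hx; have [t0|/ltW t0] := leP 0 t.
  rewrite -scalerN !sublinearZ // -mulrN; exact: ler_wpM2l.
have t0' : 0 <= - t by rewrite oppr_ge0.
have -> : t%:C *: x = (- t)%:C *: (- x).
  by rewrite rmorphN scaleNr scalerN opprK.
rewrite -scalerN !sublinearZ // -mulrN opprK; apply: ler_wpM2l => //.
by rewrite lerNr.
Qed.

(** The reverse of subadditivity comes from writing [y] as [(x + y) + (- x)], so oddness at [x]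
    alone suffices. *)
Lemma sublinear_odd_add x y : q (- x) <= - q x -> q (x + y) = q x + q y.
Proof.
move=> hx; apply/eqP; rewrite eq_le sq.1 /=.
by have := sq.1 (x + y) (- x); rewrite addrAC subrr add0r; lra.
Qed.

Lemma sublinear_odd_scale t x : q (- x) <= - q x -> q (t%:C *: x) = t * q x.
Proof.
move=> hx; have [t0|/ltW t0] := leP 0 t; first exact: sublinearZ.
have t0' : 0 <= - t by rewrite oppr_ge0.
have -> : t%:C *: x = (- t)%:C *: (- x).
  by rewrite rmorphN scaleNr scalerN opprK.
rewrite sublinearZ // mulNr -mulrN; congr (_ * _); apply/eqP.
have := sublinear_oppr_ge x sq; lra.
Qed.

Lemma sublinear_odd_sum n (F : 'I_n -> E) :
  (forall k, q (- F k) <= - q (F k)) ->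
  q (\sum_(k < n) F k) = \sum_(k < n) q (F k).
Proof.
elim: n F => [|n IHn] F hF; first by rewrite !big_ord0 sublinear0.
by rewrite !big_ord_recl sublinear_odd_add // IHn.
Qed.

End Odd.
End Sublinear.

(** * Supporting vectors of sublinear functions *)

Section Support.
Local Open Scope complex_scope.
Variables (R : realType) (d : nat).
Implicit Types (u v w x : 'cV[R[i]]_d).

Lemma braketE u x : braket u x = \sum_(j < d) (u j 0)^*%C * x j 0.
Proof. by rewrite /braket mxE; apply: eq_bigr => j _; rewrite !mxE. Qed.

Lemma ReD (a b : R[i]) : complex.Re (a + b) = complex.Re a + complex.Re b.
Proof. by case: a; case: b. Qed.

Lemma Re_sum n (F : 'I_n -> R[i]) :
  complex.Re (\sum_(k < n) F k) = \sum_(k < n) complex.Re (F k).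
Proof. exact: (big_morph _ ReD). Qed.

Lemma cV_real_basis x :
  x = \sum_(j < d) ((complex.Re (x j 0))%:C *: delta_mx j 0 +
     (complex.Im (x j 0))%:C *: ('i *: delta_mx j 0)).
Proof.
rewrite {1}[x]matrix_sum_delta; apply: eq_bigr => j _.
rewrite big_ord1 scalerA -scalerDl; congr (_ *: _).
by rewrite {1}[x j 0]complexE mulrC.
Qed.

(* The representing vector has the j-th entry q(e_j) + i q(i e_j), where [q] is
   a linearization of [p] along the real basis (e_j), (i e_j). *)
Lemma sublinear_support (p : 'cV[R[i]]_d -> R) x : sublinear p ->
  exists2 u, forall y, complex.Re (braket u y) <= p y &
    complex.Re (braket u x) = p x.
Proof.
move=> sp.
pose B := [seq delta_mx j 0 | j <- enum 'I_d] ++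
  [seq 'i *: delta_mx j 0 | j <- enum 'I_d] : seq 'cV[R[i]]_d.
have [q [sq qp qx qB]] := sublinear_linearize_at x B sp.
have q1 j : q (- delta_mx j 0) <= - q (delta_mx j 0).
  apply: qB; rewrite mem_cat; apply/orP; left; apply/mapP.
  by exists j; rewrite ?mem_enum.
have q2 j : q (- ('i *: delta_mx j 0)) <= - q ('i *: delta_mx j 0).
  apply: qB; rewrite mem_cat; apply/orP; right; apply/mapP.
  by exists j; rewrite ?mem_enum.
pose u : 'cV[R[i]]_d :=
  \col_j (q (delta_mx j 0) +i* q ('i *: delta_mx j 0)).
have uE y : complex.Re (braket u y) = q y.
  rewrite [in RHS](cV_real_basis y) sublinear_odd_sum //; last first.
    by move=> j; apply: sublinear_oddD => //; exact: sublinear_oddZ.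
  (* The conjugation in [braket] cancels the sign of ['i ^+ 2]: real parts pair with real parts and
     imaginary with imaginary, both with a plus sign. *)
  rewrite braketE Re_sum; apply: eq_bigr => j _.
  rewrite (sublinear_odd_add sq _ (sublinear_oddZ sq _ (q1 j))).
  rewrite (sublinear_odd_scale sq _ (q1 j)) (sublinear_odd_scale sq _ (q2 j)).
  rewrite mxE; case: (y j 0) => a b /=; ring.
by exists u => [y|]; rewrite uE.
Qed.

End Support.

(** * Modulus and phase of complex numbers *)

Section Phase.
Local Open Scope complex_scope.
Variable R : realType.
Implicit Types (z : R[i]) (t : R).

Lemma normc_sqr z :
  Normc.normc z ^+ 2 = complex.Re z ^+ 2 + complex.Im z ^+ 2.
Proof. by case: z => a b /=; rewrite sqr_sqrtr // addr_ge0 ?sqr_ge0. Qed.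

Lemma normc_ge0 z : 0 <= Normc.normc z.
Proof. by case: z => a b /=; exact: sqrtr_ge0. Qed.

Lemma Re_le_normc z : complex.Re z <= Normc.normc z.
Proof.
rewrite (le_trans (ler_norm _)) // -(@ler_pXn2r _ 2) ?nnegrE ?normc_ge0 //.
by rewrite normc_sqr real_normK ?num_real // lerDl sqr_ge0.
Qed.

Lemma normc_conj z : Normc.normc z^*%C = Normc.normc z.
Proof. by case: z => a b /=; rewrite sqrrN. Qed.

Lemma Re_mul_conj z : complex.Re (z^*%C * z) = Normc.normc z ^+ 2.
Proof. by rewrite normc_sqr; case: z => a b /=; ring. Qed.

Lemma expiNM t : expi (- t) * expi t = 1.
Proof.
rewrite /expi cosN sinN; apply/eqP; rewrite eq_complex /=.
by rewrite mulNr opprK -!expr2 cos2Dsin2 eqxx /= mulNr mulrC subrr.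
Qed.

(** For nonzero [z], [acos] of the normalised real part gives the angle up to sign, and the sign of
    the imaginary part selects it. *)
Lemma expi_normc z : exists t, z = (Normc.normc z)%:C * expi t.
Proof.
have [z0|zn0] := eqVneq (Normc.normc z) 0.
  by exists 0; rewrite z0 mul0r; exact: Normc.eq0_normc.
have := normc_sqr z; case: z zn0 => a b; set n := Normc.normc _ => /= zn0 nE.
have n2 : n ^+ 2 != 0 by rewrite expf_neq0.
have n0 : 0 <= n by exact: normc_ge0.
have ab1 : 1 - (a / n) ^+ 2 = (b / n) ^+ 2.
  rewrite !expr_div_n; apply: (mulIf n2); rewrite mulrBl !mulfVK // mul1r nE.
  ring.
have a1 : -1 <= a / n <= 1.
  rewrite -ler_norml -(@ler_pXn2r _ 2) ?nnegrE //.
  by rewrite real_normK ?num_real // expr1n -subr_ge0 ab1 sqr_ge0.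
have [b0|/ltW b0] := leP 0 b.
  exists (acos (a / n)); apply/eqP; rewrite eq_complex /= !mul0r subr0 addr0.
  rewrite acosK ?in_itv // sin_acos // ab1 sqrtr_sqr ger0_norm ?divr_ge0 //.
  by rewrite ![n * _]mulrC !mulfVK ?eqxx.
exists (- acos (a / n)); apply/eqP; rewrite eq_complex /= !mul0r subr0 addr0.
rewrite cosN sinN acosK ?in_itv // sin_acos // ab1 sqrtr_sqr.
rewrite ler0_norm ?mulr_le0_ge0 ?invr_ge0 // opprK.
by rewrite ![n * _]mulrC !mulfVK ?eqxx.
Qed.

Lemma expi_mul_normc z : exists t, expi t * z = (Normc.normc z)%:C.
Proof.
have [t zE] := expi_normc z; exists (- t).
by rewrite {1}zE mulrCA expiNM mulr1.
Qed.

End Phase.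

(** * Squares of extended-real suprema and infima *)

Section ErealSquare.
Variable R : realType.
Local Open Scope ereal_scope.
Implicit Types (x y : \bar R) (r : R).

(** Both sides are compared through [sqrte x]. Nonemptiness matters: the supremum of the empty set
    is [-oo], whose square is [+oo]. *)
Lemma ereal_sup_sqr_le (S : set (\bar R)) x : S !=set0 ->
  (forall y, S y -> 0 <= y /\ y ^+ 2 <= x) -> ereal_sup S ^+ 2 <= x.
Proof.
move=> [y0 Sy0] SP; have [y00 y0x] := SP _ Sy0.
have x0 := le_trans (sqre_ge0 _) y0x.
rewrite -(sqr_sqrte x0) lee_sqr ?sqrte_ge0 //.
  by apply: ge_ereal_sup => y /SP[_ yx]; rewrite lee_sqrE ?sqrte_ge0 ?sqr_sqrte.
by apply: le_trans y00 _; exact: ereal_sup_ubound.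
Qed.

Lemma ereal_inf_sqr_ge (S : set (\bar R)) x :
  (forall y, S y -> 0 <= y /\ x <= y ^+ 2) -> 0 <= x -> x <= ereal_inf S ^+ 2.
Proof.
move=> SP x0; rewrite -(sqr_sqrte x0).
have sx : sqrte x <= ereal_inf S.
  by apply: le_ereal_inf_tmp => y /SP[y0 xy]; rewrite lee_sqrE ?sqr_sqrte.
by rewrite lee_sqr ?sqrte_ge0 // (le_trans (sqrte_ge0 x)).
Qed.

End ErealSquare.

(** * Sublinearity of atomic gauges *)

Section Gauge.
Local Open Scope complex_scope.
Variables (R : realType) (W : lmodType R[i]) (A : set W).
Local Open Scope ereal_scope.
Implicit Types (x y : W) (t : R).

Lemma gauge_le n (c : 'I_n -> R) (a : 'I_n -> W) :
  (forall k, (0 <= c k)%R) -> (forall k, A (a k)) ->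
  gauge A (\sum_(k < n) (c k)%:C *: a k)%R <= (\sum_(k < n) c k)%:E.
Proof. by move=> c0 Aa; apply: ereal_inf_lbound; exists n, c, a. Qed.

Lemma le_gauge x l :
  (forall n (c : 'I_n -> R) (a : 'I_n -> W),
    (forall k, (0 <= c k)%R) -> (forall k, A (a k)) ->
    (x = \sum_(k < n) (c k)%:C *: a k)%R -> l <= (\sum_(k < n) c k)%:E) ->
  l <= gauge A x.
Proof.
move=> lP; apply: le_ereal_inf_tmp => _ [n [c [a [c0 Aa xE ->]]]].
exact: (lP _ c a).
Qed.

Lemma gauge_ge0 x : 0 <= gauge A x.
Proof. by apply: le_gauge => n c a c0 _ _; rewrite lee_fin sumr_ge0. Qed.

Lemma gaugeD x y : gauge A (x + y)%R <= gauge A x + gauge A y.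
Proof.
(* Optimising over the two decompositions one at a time moves [gauge A y] across the inequality,
   which requires it to be finite. *)
have [gy|gy] := eqVneq (gauge A y) +oo.
  by rewrite gy addey ?leey // gt_eqF // (lt_le_trans _ (gauge_ge0 x)).
have gyfin : gauge A y \is a fin_num by rewrite ge0_fin_numE ?gauge_ge0 // ltey.
rewrite -leeBlDr //; apply: le_gauge => n c a c0 Aa xE.
rewrite leeBlDr // -leeBlDl //; apply: le_gauge => m c' a' c'0 Aa' yE.
rewrite leeBlDl // -EFinD xE yE.
pose cc k := match fintype.split k with inl i => c i | inr j => c' j end.
pose aa k := match fintype.split k with inl i => a i | inr j => a' j end.
have ccl i : cc (lshift m i) = c i.
  by rewrite /cc -[lshift m i]/(unsplit (inl i)) unsplitK.
have ccr j : cc (rshift n j) = c' j.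
  by rewrite /cc -[rshift n j]/(unsplit (inr j)) unsplitK.
have aal i : aa (lshift m i) = a i.
  by rewrite /aa -[lshift m i]/(unsplit (inl i)) unsplitK.
have aar j : aa (rshift n j) = a' j.
  by rewrite /aa -[rshift n j]/(unsplit (inr j)) unsplitK.
have -> : (\sum_(k < n) c k + \sum_(k < m) c' k = \sum_(k < n + m) cc k)%R.
  rewrite big_split_ord; congr (_ + _)%R; apply: eq_bigr => k _.
    by rewrite -ccl.
  by rewrite -ccr.
have -> : (\sum_(k < n) (c k)%:C *: a k + \sum_(k < m) (c' k)%:C *: a' k =
    \sum_(k < n + m) (cc k)%:C *: aa k)%R.
  rewrite big_split_ord; congr (_ + _)%R; apply: eq_bigr => k _.
    by rewrite -ccl -aal.
  by rewrite -ccr -aar.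
by apply: gauge_le => k; rewrite /cc /aa; case: fintype.split.
Qed.

Lemma gauge0 : gauge A 0%R = 0.
Proof.
apply/eqP; rewrite eq_le gauge_ge0 andbT.
have := @gauge_le 0 (fun=> 0%R) (fun=> 0%R); rewrite !big_ord0; apply.
  by case. by case.
Qed.

Lemma gauge_sum n (F : 'I_n -> W) :
  gauge A (\sum_(k < n) F k)%R <= \sum_(k < n) gauge A (F k).
Proof.
elim: n F => [|n IHn] F; first by rewrite !big_ord0 gauge0.
by rewrite !big_ord_recl (le_trans (gaugeD _ _)) // leeD2l.
Qed.

Lemma gauge_atomZ t a : (0 <= t)%R -> A a -> gauge A (t%:C *: a)%R <= t%:E.
Proof.
move=> t0 Aa; have := @gauge_le 1 (fun=> t) (fun=> a).
by rewrite !big_ord1; exact.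
Qed.

Lemma gaugeZ t x : (0 <= t)%R -> gauge A (t%:C *: x)%R <= t%:E * gauge A x.
Proof.
(* At [t = 0] the convention [0 * +oo = 0] makes the right side zero even for an infinite gauge; the
   empty sum decomposes [0]. *)
rewrite le_eqVlt => /predU1P[<-|t0]; first by rewrite mul0e scale0r gauge0.
rewrite -lee_pdivrMl //; apply: le_gauge => n c a c0 Aa ->.
rewrite lee_pdivrMl // -EFinM mulr_sumr scaler_sumr.
under eq_bigr do rewrite scalerA -rmorphM.
by apply: gauge_le => // k; rewrite mulr_ge0 // ltW.
Qed.

End Gauge.

(** * Brakets and decompositions of pure states *)

Section BraketTheory.
Local Open Scope complex_scope.
Variables (R : realType) (d : nat).
Implicit Types (u v w x y : 'cV[R[i]]_d) (a : R[i]).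

Lemma braketDr u x y : braket u (x + y) = braket u x + braket u y.
Proof. by rewrite /braket mulmxDr mxE. Qed.

Lemma braketZr u a x : braket u (a *: x) = a * braket u x.
Proof. by rewrite /braket -scalemxAr mxE. Qed.

Lemma braket_sumr u n (F : 'I_n -> 'cV[R[i]]_d) :
  braket u (\sum_(k < n) F k) = \sum_(k < n) braket u (F k).
Proof. by rewrite /braket mulmx_sumr summxE. Qed.

Lemma braketC u x : braket x u = (braket u x)^*%C.
Proof.
rewrite !braketE rmorph_sum; apply: eq_bigr => j _.
by rewrite rmorphM /= conjcK mulrC.
Qed.

Lemma braketZl u a x : braket (a *: u) x = a^*%C * braket u x.
Proof. by rewrite braketC braketZr rmorphM /= -braketC. Qed.

Lemma braket_eq0 x : braket x x = 0 -> x = 0.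
Proof.
move=> /(congr1 (@complex.Re R)); rewrite braketE Re_sum /= => /eqP.
under eq_bigr do rewrite Re_mul_conj.
rewrite psumr_eq0 => [/allP xj0|j _]; last exact: sqr_ge0.
apply/matrixP => j k; rewrite ord1 mxE; apply: Normc.eq0_normc; apply/eqP.
by have := xj0 j; rewrite mem_index_enum sqrf_eq0; exact.
Qed.

Lemma ketbraE v w i j : ketbra v w i j = v i 0 * (w j 0)^*%C.
Proof. by rewrite mxE big_ord1 !mxE. Qed.

Lemma ketbra_mul v w x : ketbra v w *m x = braket w x *: v.
Proof.
by rewrite /ketbra -mulmxA [_ *m x]mx11_scalar mul_mx_scalar.
Qed.

Lemma sandwich_ketbra u v w x :
  sandwich u (ketbra v w) x = braket u v * braket w x.
Proof. by rewrite /sandwich ketbra_mul braketZr mulrC. Qed.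

Lemma sandwich_sum u x n (c : 'I_n -> R[i]) (v w : 'I_n -> 'cV[R[i]]_d) :
  sandwich u (\sum_(k < n) c k *: ketbra (v k) (w k)) x =
  \sum_(k < n) c k * (braket u (v k) * braket (w k) x).
Proof.
rewrite /sandwich mulmx_suml braket_sumr; apply: eq_bigr => k _.
by rewrite -scalemxAl braketZr -sandwich_ketbra.
Qed.

Lemma Re_scalar_mul (t : R) a : complex.Re (t%:C * a) = t * complex.Re a.
Proof. by case: a => r s /=; rewrite mul0r subr0. Qed.

(* Testing the decomposition against the component [y] of [phi k] orthogonal to
   [psi] forces [y = 0]. *)
Lemma pure_state_decomposition psi n (p : 'I_n -> R)
    (phi : 'I_n -> 'cV[R[i]]_d) k :
  unit_vector psi -> (forall k, 0 <= p k) ->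
  (forall k, unit_vector (phi k)) ->
  ketbra psi psi = \sum_(k < n) (p k)%:C *: ketbra (phi k) (phi k) ->
  p k != 0 -> exists t, phi k = expi t *: psi.
Proof.
move=> psi1 p0 phi1 psiE pk0.
pose a := braket psi (phi k); pose y := phi k + (- a) *: psi.
have psiy : braket psi y = 0.
  by rewrite braketDr braketZr psi1 mulr1 addrN.
have phiy : braket (phi k) y = 0.
  (* The left side vanishes as [y] is orthogonal to [psi]; the right side is a sum of nonnegative
     terms [p j * |<phi j|y>|^2], so each of them is zero. *)
  have := congr1 (fun X => complex.Re (sandwich y X y)) psiE.
  rewrite /= sandwich_ketbra psiy mulr0 sandwich_sum Re_sum /=.
  under eq_bigr => j _.
    rewrite Re_scalar_mul (braketC (phi j) y) Re_mul_conj; over.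
  move=> /esym/eqP; rewrite psumr_eq0 => [/allP h|j _]; last first.
    by rewrite mulr_ge0 ?sqr_ge0.
  have := h k; rewrite mem_index_enum => /(_ isT).
  by rewrite mulf_eq0 (negbTE pk0) sqrf_eq0 => /eqP/Normc.eq0_normc.
have phiE : phi k = a *: psi.
  apply/eqP; rewrite -subr_eq0 -scaleNr -/y; apply/eqP/braket_eq0.
  rewrite {2}/y braketDr braketZr !(braketC _ y) phiy psiy.
  by rewrite conjc0 mulr0 addr0.
have a1 : Normc.normc a = 1.
  have := phi1 k; rewrite /unit_vector phiE braketZl braketZr psi1 mulr1.
  move=> /(congr1 (@complex.Re R)); rewrite Re_mul_conj /= => /eqP.
  by rewrite sqrp_eq1 ?normc_ge0 // => /eqP.
have [t aE] := expi_normc a; exists t.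
by rewrite phiE aE a1 mul1r.
Qed.

End BraketTheory.

(** * Gauges and convex roof of a pure state *)

Section StateGauges.
Local Open Scope complex_scope.
Variables (R : realType) (d : nat) (V : set 'cV[R[i]]_d).
Hypothesis V_phase : forall (v : 'cV[R[i]]_d) (t : R), V v -> V (expi t *: v).
Implicit Types (u v w x psi : 'cV[R[i]]_d).

(** The phase is absorbed into the atoms, leaving the coefficients unchanged. *)
Lemma gauge_phase_le t x : (gauge V (expi t *: x) <= gauge V x)%E.
Proof.
apply: le_gauge => n c a c0 Va ->; rewrite scaler_sumr.
under eq_bigr do rewrite scalerA mulrC -scalerA.
by apply: gauge_le => // k; exact: V_phase.
Qed.

Lemma gauge_phase t x : gauge V (expi t *: x) = gauge V x.
Proof.
apply/eqP; rewrite eq_le gauge_phase_le /=.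
by rewrite -{1}[x]scale1r -(expiNM t) -scalerA gauge_phase_le.
Qed.

(** Each complex coordinate is a nonnegative modulus times a phase; the phase does not affect the
    gauge, so every term has a finite one. *)
Lemma gauge_span_fin_num (s : seq 'cV[R[i]]_d) x :
  (forall v, v \in s -> V v) -> x \in span s -> gauge V x \is a fin_num.
Proof.
move=> sV xs; rewrite ge0_fin_numE ?gauge_ge0 //.
rewrite (coord_span (X := in_tuple s) xs).
apply: le_lt_trans (gauge_sum _ _) _.
apply: lte_sum_pinfty => k _.
have [t ->] := expi_normc (coord (in_tuple s) k x).
rewrite -scalerA; apply: le_lt_trans (gaugeZ _ _ (normc_ge0 _)) _.
apply: lte_mul_pinfty; rewrite ?lee_fin ?normc_ge0 //.
rewrite gauge_phase -[X in gauge V X]scale1r.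
apply: le_lt_trans (gauge_atomZ ler01 _) _; last by rewrite ltry.
by apply: sV; rewrite mem_nth.
Qed.

(* Composing with a projection onto the span makes the gauge finite everywhere,
   hence a real-valued sublinear function. *)
Lemma gauge_support (s : seq 'cV[R[i]]_d) psi :
  (forall v, v \in s -> V v) -> psi \in span s ->
  exists2 u, forall v, v \in s -> Normc.normc (braket u v) <= 1 &
    gauge V psi = (complex.Re (braket u psi))%:E.
Proof.
move=> sV psis; pose P := projv (span s).
have Pfin x : gauge V (P x) \is a fin_num.
  by apply: (gauge_span_fin_num sV); exact: memv_proj.
pose p x := fine (gauge V (P x)).
have sp : sublinear p.
  split=> [x y|t x t0]; rewrite -lee_fin /p.
    by rewrite EFinD !fineK // linearD gaugeD.
  by rewrite EFinM !fineK // linearZ gaugeZ.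
have [u up upsi] := sublinear_support psi sp; exists u => [v vs|]; last first.
  by rewrite upsi /p fineK // /P projv_id.
(* Rotating [v] makes [<u|v>] real and nonnegative, so a bound on real parts bounds the modulus. *)
have [t tE] := expi_mul_normc (braket u v).
have -> : Normc.normc (braket u v) = complex.Re (braket u (expi t *: v)).
  by rewrite braketZr tE.
apply: le_trans (up _) _; rewrite -lee_fin fineK //.
rewrite linearZ /= gauge_phase [P v]projv_id ?memv_span //.
by rewrite -[v]scale1r (gauge_atomZ ler01) //; exact: sV.
Qed.

Lemma gauge_sqr_le_atoms_S psi : in_span V psi ->
  (gauge V psi ^+ 2 <= gauge (atoms_S V) (ketbra psi psi))%E.
Proof.
move=> [s0 s0V psis0]; apply: le_gauge => n c X c0 XS psiE.
have /choice[vw vwP] k : exists vw : 'cV[R[i]]_d * 'cV[R[i]]_d,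
    [/\ V vw.1, V vw.2 & X k = ketbra vw.1 vw.2].
  by have [v [w vwX]] := XS k; exists (v, w).
(* One finite list spans [psi] and contains both vectors of every atom, so a single [u] serves for
   all. *)
pose s := s0 ++ [seq (vw k).1 | k <- enum 'I_n] ++
  [seq (vw k).2 | k <- enum 'I_n].
have sV v : v \in s -> V v.
  rewrite !mem_cat => /or3P[/s0V//|/mapP[k _ ->]|/mapP[k _ ->]];
    by have [] := vwP k.
have psis : psi \in span s.
  by rewrite span_cat (subvP (addvSl _ _)).
have s1 k : (vw k).1 \in s.
  rewrite !mem_cat; apply/or3P/Or32/mapP; exists k => //; exact: mem_enum.
have s2 k : (vw k).2 \in s.
  rewrite !mem_cat; apply/or3P/Or33/mapP; exists k => //; exact: mem_enum.
have [u u1 ->] := gauge_support sV psis.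
rewrite -EFin_expe lee_fin.
have {}psiE : ketbra psi psi =
    \sum_(k < n) (c k)%:C *: ketbra (vw k).1 (vw k).2.
  by rewrite psiE; apply: eq_bigr => k _; have [_ _ ->] := vwP k.
apply: (@le_trans _ _ (complex.Re (sandwich u (ketbra psi psi) u))).
  rewrite sandwich_ketbra (braketC u psi) mulrC Re_mul_conj normc_sqr.
  by rewrite lerDl sqr_ge0.
rewrite psiE sandwich_sum Re_sum; apply: ler_sum => k _.
(* Each factor [<u|v_k>] and [<w_k|u>] has modulus at most 1, so the k-th term is at most [c k]. *)
rewrite Re_scalar_mul ler_piMr // (le_trans (Re_le_normc _)) //.
rewrite Normc.normcM (braketC u (vw k).2) normc_conj.
by rewrite mulr_ile1 ?normc_ge0 ?u1.
Qed.

(** Expanding both factors of [|psi><psi|] along one decomposition of [psi] gives atoms [|a_k><a_l|]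
    with weights [c k * c l], whose total is the square of the sum of the [c k]. *)
Lemma gauge_atoms_S_le psi :
  (gauge (atoms_S V) (ketbra psi psi) <= gauge V psi ^+ 2)%E.
Proof.
apply: ereal_inf_sqr_ge; last exact: gauge_ge0.
move=> _ [n [c [a [c0 Va psiE ->]]]]; split; first by rewrite lee_fin sumr_ge0.
have -> : ketbra psi psi =
    \sum_(k < n) \sum_(l < n) (c k * c l)%:C *: ketbra (a k) (a l).
  apply/matrixP => i j; rewrite ketbraE psiE !summxE rmorph_sum mulr_suml.
  apply: eq_bigr => k _; rewrite summxE mulr_sumr; apply: eq_bigr => l _.
  rewrite [RHS]mxE ketbraE !mxE rmorphM
    [X in (c k)%:C * a k i 0 * (X * _)]conjc_real.
  by rewrite mulrACA -rmorphM.
apply: le_trans (gauge_sum _ _) _.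
rewrite -EFin_expe expr2 mulr_suml -sumEFin; apply: lee_sum => k _.
apply: le_trans (gauge_sum _ _) _.
rewrite mulr_sumr -sumEFin; apply: lee_sum => l _.
by apply: gauge_atomZ; [exact: mulr_ge0|exists (a k), (a l)].
Qed.

Lemma convex_roof_pure psi : unit_vector psi ->
  convex_roof V (ketbra psi psi) = (gauge V psi ^+ 2)%E.
Proof.
move=> psi1; apply/eqP; rewrite eq_le; apply/andP; split.
  apply: ereal_inf_lbound; exists 1%N, (fun=> 1), (fun=> psi).
  by rewrite !big_ord1 scale1r mul1e.
apply: le_ereal_inf_tmp => _ [n [p [phi [p0 p1 phi1 psiE ->]]]].
have -> : (\sum_(k < n) (p k)%:E * gauge V (phi k) ^+ 2 =
    \sum_(k < n) (p k)%:E * gauge V psi ^+ 2)%E.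
  (* Only a state of nonzero weight is known to be a phase multiple of [psi]; a zero weight
     annihilates even an infinite gauge. *)
  apply: eq_bigr => k _; have [->|pk0] := eqVneq (p k) 0.
    by rewrite !mul0e.
  have [t ->] := pure_state_decomposition psi1 p0 phi1 psiE pk0.
  by rewrite gauge_phase.
rewrite -ge0_sume_distrl; last by move=> k _; rewrite lee_fin.
by rewrite sumEFin p1 mul1e.
Qed.

(** * Polar gauges of a pure state *)

Lemma polar_V_ge0 psi : V !=set0 -> (0 <= polar_V V psi)%E.
Proof.
move=> [v Vv]; apply: (@le_trans _ _ (Normc.normc (braket psi v))%:E).
  by rewrite lee_fin normc_ge0.
by apply: ereal_sup_ubound; exists v.
Qed.

Lemma normc_le_polar_V psi v : V v ->
  ((Normc.normc (braket psi v))%:E <= polar_V V psi)%E.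
Proof. by move=> Vv; apply: ereal_sup_ubound; exists v. Qed.

Lemma polar_V_sqr_le psi l : V !=set0 ->
  (forall v, V v -> ((Normc.normc (braket psi v) ^+ 2)%:E <= l)%E) ->
  (polar_V V psi ^+ 2 <= l)%E.
Proof.
move=> [v0 Vv0] lP; apply: ereal_sup_sqr_le.
  by exists (Normc.normc (braket psi v0))%:E, v0.
by move=> _ [v Vv <-]; rewrite lee_fin normc_ge0 -EFin_expe lP.
Qed.

Lemma polar_Splus_pure psi : V !=set0 ->
  polar_Splus V (ketbra psi psi) = (polar_V V psi ^+ 2)%E.
Proof.
move=> V0.
have sE v : complex.Re (sandwich v (ketbra psi psi) v) =
    Normc.normc (braket psi v) ^+ 2.
  by rewrite sandwich_ketbra (braketC psi v) Re_mul_conj.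
apply/eqP; rewrite eq_le; apply/andP; split.
  rewrite /polar_Splus ge_max sqre_ge0 /=; apply: ge_ereal_sup => _ [v Vv <-].
  rewrite sE EFin_expe lee_sqr ?lee_fin ?normc_ge0 ?polar_V_ge0 //.
  exact: normc_le_polar_V.
apply: polar_V_sqr_le => // v Vv; rewrite /polar_Splus le_max; apply/orP; right.
by apply: ereal_sup_ubound; exists v; rewrite // sE.
Qed.

Lemma polar_S_pure psi : V !=set0 ->
  polar_S V (ketbra psi psi) = (polar_V V psi ^+ 2)%E.
Proof.
move=> V0.
have sE v w : Normc.normc (sandwich v (ketbra psi psi) w) =
    Normc.normc (braket psi v) * Normc.normc (braket psi w).
  by rewrite sandwich_ketbra (braketC psi v) Normc.normcM normc_conj.
apply/eqP; rewrite eq_le; apply/andP; split.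
  apply: ge_ereal_sup => _ [v [w [Vv Vw ->]]]; rewrite sE EFinM expe2.
  by apply: lee_pmul; rewrite ?lee_fin ?normc_ge0 ?normc_le_polar_V.
(* The diagonal choice [w = v] already attains each squared modulus. *)
apply: polar_V_sqr_le => // v Vv; apply: ereal_sup_ubound.
by exists v, v; rewrite sE expr2.
Qed.

End StateGauges.

Theorem theorem6 (R : realType) (d : nat) (hd : (1 <= d)%N)
    (V : set 'cV[R[i]]_d)
    (V_nonempty : V !=set0)
    (V_compact : compact_vectors V)
    (V_unit : forall psi : 'cV[R[i]]_d, V psi -> unit_vector psi)
    (V_phase : forall (psi : 'cV[R[i]]_d) (theta : R),
       V psi -> V (expi theta *: psi)) :
  (forall psi : 'cV[R[i]]_d, unit_vector psi -> in_span V psi ->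
     convex_roof V (ketbra psi psi) = (gauge V psi ^+ 2)%E /\
     gauge (atoms_S V) (ketbra psi psi) = (gauge V psi ^+ 2)%E) /\
  (forall psi : 'cV[R[i]]_d, unit_vector psi ->
     polar_Splus V (ketbra psi psi) = (polar_V V psi ^+ 2)%E /\
     polar_S V (ketbra psi psi) = (polar_V V psi ^+ 2)%E).
Proof.
split=> psi psi1 => [psiV|].
  split; first exact: convex_roof_pure.
  by apply/eqP; rewrite eq_le gauge_atoms_S_le gauge_sqr_le_atoms_S.
by split; [exact: polar_Splus_pure|exact: polar_S_pure].
Qed.
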